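(* Let $\{\mu_n\}_{n\geq 1}$ be a sequence of probability measures on $\mathbb{R}$, each with variance $1$ and mean $0$, such that for every $n\geq 1$ the measure $\mu_n$ is $n$-divisible with respect to classical convolution. Let $X_n$ be a random variable with distribution $\mu_n$. If $E[X_n^4]\rightarrow 3$ as $n\to\infty$, then $\mu_n$ converges in distribution (weakly) to $\mathcal{N}(0,1)$ as $n\to\infty$.
   Context: $\mathcal{N}(0,1)$ is the standard Gaussian law. A probability measure $\mu$ on $\mathbb{R}$ is $n$-divisible with respect to classical convolution $*$ if $\mu=\rho^{*n}$ (the $n$-fold convolution) for some probability measure $\rho$ on $\mathbb{R}$. *)

(* Defs.v *)
From HB Require Import structures.
From mathcomp Require Import all_boot all_order all_algebra.
From mathcomp Require Import all_classical all_reals all_analysis.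
From mathcomp Require Import measurable_realfun.

Set Implicit Arguments.
Unset Strict Implicit.
Unset Printing Implicit Defensive.

Import Order.TTheory GRing.Theory Num.Theory.
Import numFieldNormedType.Exports.

Local Open Scope classical_set_scope.
Local Open Scope ring_scope.

Section definitions.
Context {R : realType}.
Local Notation mR := (measurableTypeR R).

Definition add_pair (z : mR * mR) : mR := (z.1 : R) + z.2.

Lemma measurable_add_pair : measurable_fun [set: mR * mR] add_pair.
Proof. exact: measurable_funD measurable_fst measurable_snd. Qed.

HB.instance Definition _ :=
  isMeasurableFun.Build _ _ _ _ add_pair measurable_add_pair.

Definition convolution (mu nu : probability mR R) : probability mR R :=
  distribution (mu \x nu)%E add_pair.

Fixpoint convolution_pow (rho : probability mR R) (n : nat) :
    probability mR R :=
  if n is m.+1 then convolution rho (convolution_pow rho m) else \d_(0 : mR).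

(* Measures are functions on all sets, whose values outside the measurable
   sets carry no meaning, so measures are compared on measurable sets only. *)
Definition divisible (n : nat) (mu : probability mR R) : Prop :=
  exists rho : probability mR R,
    forall A : set mR, measurable A -> mu A = convolution_pow rho n A.

Definition has_law d (T : measurableType d) (P : probability T R)
    (X : {RV P >-> mR}) (mu : probability mR R) : Prop :=
  forall A : set mR, measurable A -> distribution P X A = mu A.

Definition weak_cvg (mu_ : nat -> probability mR R) (nu : probability mR R) :
    Prop :=
  forall f : R -> R, continuous f -> bounded_fun f ->
    (\int[mu_ n]_x (f x)%:E)%E @[n --> \oo] --> (\int[nu]_x (f x)%:E)%E.

End definitions.

(* Main.v *)
(* Stein's method. For h bounded and Lipschitz let f solve
   f'(x) - x f(x) = h(x) - E h(N(0,1)); then E h(S) - E h(N(0,1)) equals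
   E[f'(S) - S f(S)]. Write S, distributed as mu_n, as Y + S' with Y one of its
   n independent identically distributed summands. By exchangeability
   E[S f(S)] = n E[Y f(Y + S')], and as Y is centred with variance 1/n, Taylor
   expansion at S' leaves errors bounded by n E|Y|^3 and E|Y|, up to a factor
   depending only on h. Since E[S^4] = n E[Y^4] + 3 - 3/n, the hypothesis says
   n E[Y^4] -> 0, and n E|Y|^3 is at most (t + n E[Y^4] / t) / 2 for every
   t > 0. Bounded continuous functions are reduced to Lipschitz ones by
   inf-convolution. *)
Require Import Defs.
From mathcomp Require Import all_boot all_order all_algebra.
From mathcomp Require Import all_classical all_reals all_analysis.
From mathcomp Require Import measurable_realfun.
From mathcomp Require Import ring lra.

Set Implicit Arguments.
Unset Strict Implicit.
Unset Printing Implicit Defensive.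

Import Order.TTheory GRing.Theory Num.Theory.
Import numFieldNormedType.Exports.

Local Open Scope classical_set_scope.
Local Open Scope ring_scope.

(** Divisibility provides the law of a summand with no information on its moments, and the fourth
    moment of [mu_n] is itself known to be finite only for large n; it has to be passed from the sum
    to the summand. Independence is expressed by product measures: S is never built from n random
    variables, only as a pair (Y, S') under [rho \x convolution_pow rho n], so that exchangeability
    becomes an induction on Fubini's theorem. As h is merely Lipschitz, f need not have a second
    derivative, and the available bound on the increments of f' grows linearly with the base point.
    Expanding at S', which is independent of Y, lets the growth factor 1 + |S'| be integrated
    separately, where it costs at most 2. In the resulting bound L (2t + (E[S^4] - 3 + 4/n) / t) the
    constant L depends on h alone, so t can be fixed from the tolerance before n grows. *)

Local Notation intg P f := (integrable P [set: _] (EFin \o f)).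

(** * Integrals of real-valued functions *)

Section real_integrals.
Context d (T : measurableType d) (R : realType).
Implicit Types (P : {measure set T -> \bar R}) (f g : T -> R).

Lemma integrable_cst_prob (P : probability T R) (c : R) : intg P (fun=> c).
Proof. exact: finite_measure_integrable_cst. Qed.

Lemma integrable_le_fun P f g : measurable_fun [set: T] f ->
  (forall x, `|f x| <= g x) -> intg P g -> intg P f.
Proof.
move=> mf fg ig; apply: le_integrable ig => //; first exact/measurable_EFinP.
by move=> x _ /=; rewrite lee_fin (le_trans (fg x))// ler_norm.
Qed.

Lemma integrable_bounded (P : probability T R) f (B : R) : measurable_fun [set: T] f ->
  (forall x, `|f x| <= B) -> intg P f.
Proof.
by move=> mf fB; exact: integrable_le_fun mf fB (integrable_cst_prob P B).
Qed.

Lemma integrable_add P f g : intg P f -> intg P g -> intg P (fun x => f x + g x).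
Proof.
by move=> fi gi; apply: eq_integrable (integrableD measurableT fi gi).
Qed.

Lemma integrable_sub P f g : intg P f -> intg P g -> intg P (fun x => f x - g x).
Proof.
by move=> fi gi; apply: eq_integrable (integrableB measurableT fi gi).
Qed.

Lemma integrable_scale P f (c : R) : intg P f -> intg P (fun x => c * f x).
Proof.
by move=> fi; apply: eq_integrable (integrableZl measurableT c fi).
Qed.

Lemma integrable_sumr P I (s : seq I) (F : I -> T -> R) :
  (forall i, intg P (F i)) -> intg P (fun x => \sum_(i <- s) F i x).
Proof.
move=> Fi; have := integrable_sum measurableT s (P := xpredT) (fun i _ => Fi i).
by apply: eq_integrable => // x _ /=; rewrite sumEFin.
Qed.

Lemma Rintegral_sumr P I (s : seq I) (F : I -> T -> R) :
  (forall i, intg P (F i)) ->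
  \int[P]_x (\sum_(i <- s) F i x) = \sum_(i <- s) \int[P]_x F i x.
Proof.
move=> Fi; elim: s => [|i s ih].
  rewrite big_nil; under eq_Rintegral do rewrite big_nil.
  by rewrite /Rintegral integral0.
under eq_Rintegral do rewrite big_cons.
by rewrite RintegralD ?big_cons ?ih//; exact: integrable_sumr.
Qed.

Lemma Rintegral_prob_cst (P : probability T R) (c : R) : \int[P]_x c = c.
Proof.
rewrite /Rintegral integral_cst// [X in (_ * X)%E](_ : _ = 1%E) ?mule1//.
exact: probability_setT.
Qed.

Lemma integrable_measurable P f : intg P f -> measurable_fun [set: T] f.
Proof. by move=> /(measurable_int P) /measurable_EFinP. Qed.

Lemma EFin_Rintegral P f : intg P f -> (\int[P]_x (f x)%:E)%E = (\int[P]_x f x)%:E.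
Proof. by move=> fi; rewrite fineK//; exact: integrable_fin_num. Qed.

Lemma Rintegral_le_norm P f g : measurable_fun [set: T] f -> intg P g ->
  (forall x, `|f x| <= g x) -> `|\int[P]_x f x| <= \int[P]_x g x.
Proof.
move=> mf gi fg; have fi := integrable_le_fun mf fg gi.
apply: (le_trans (le_normr_Rintegral measurableT fi)).
by apply: le_Rintegral => //; exact: integrable_norm.
Qed.

End real_integrals.

(** * Fubini's theorem for two probability measures, with real-valued integrals *)

Section product.
Context d1 d2 (T1 : measurableType d1) (T2 : measurableType d2) (R : realType).
Variables (P : probability T1 R) (Q : probability T2 R).

Lemma integrable_prod (f : T1 -> R) (g : T2 -> R) : intg P f -> intg Q g ->
  intg (P \x Q)%E (fun z => f z.1 * g z.2).
Proof.
move=> fi gi.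
have mf := integrable_measurable fi; have mg := integrable_measurable gi.
apply/integrable12ltyP.
  by apply/measurable_EFinP; apply: measurable_funM; exact: measurableT_comp.
have hE x : (\int[Q]_y `|(f x * g y)%:E| = `|f x|%:E * \int[Q]_y `|(g y)%:E|)%E.
  under eq_integral do rewrite /= normrM EFinM.
  rewrite ge0_integralZl//.
  exact/measurable_EFinP/measurableT_comp.
under eq_integral do rewrite hE.
have gN := integrable_norm gi; have fN := integrable_norm fi.
under eq_integral do rewrite EFin_Rintegral//.
rewrite ge0_integralZr//.
- by rewrite EFin_Rintegral// -EFinM ltry.
- exact/measurable_EFinP/measurableT_comp.
- by rewrite lee_fin Rintegral_ge0.
Qed.

(** Integrability of every section, rather than of almost every one, makes the inner extended-real
    integral finite at each point, so that it can be replaced by its real value. *)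
Lemma Rintegral_prod12 (h : T1 * T2 -> R) : intg (P \x Q)%E h ->
  (forall x, intg Q (fun y => h (x, y))) ->
  \int[(P \x Q)%E]_z h z = \int[P]_x \int[Q]_y h (x, y).
Proof.
move=> hi hx; rewrite {1}/Rintegral -(integral12_prod_meas1 hi).
by congr fine; apply: eq_integral => x _; rewrite /fubini_F /= EFin_Rintegral.
Qed.

Lemma Rintegral_prod21 (h : T1 * T2 -> R) : intg (P \x Q)%E h ->
  (forall y, intg P (fun x => h (x, y))) ->
  \int[(P \x Q)%E]_z h z = \int[Q]_y \int[P]_x h (x, y).
Proof.
move=> hi hx; rewrite {1}/Rintegral -(integral21_prod_meas1 hi).
by congr fine; apply: eq_integral => x _; rewrite /fubini_G /= EFin_Rintegral.
Qed.

Lemma Rintegral_prod (f : T1 -> R) (g : T2 -> R) : intg P f -> intg Q g ->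
  \int[(P \x Q)%E]_z (f z.1 * g z.2) = \int[P]_x f x * \int[Q]_y g y.
Proof.
move=> fi gi; rewrite Rintegral_prod12.
- by rewrite /=; under eq_Rintegral do rewrite RintegralZl//; rewrite RintegralZr.
- exact: integrable_prod.
- by move=> x; exact: integrable_scale (f x) gi.
Qed.

Lemma integrable_fst (f : T1 -> R) : intg P f -> intg (P \x Q)%E (fun z => f z.1).
Proof.
move=> fi; apply: eq_integrable (integrable_prod fi (integrable_cst_prob Q 1)) => //.
by move=> z _ /=; rewrite mulr1.
Qed.

Lemma integrable_snd (g : T2 -> R) : intg Q g -> intg (P \x Q)%E (fun z => g z.2).
Proof.
move=> gi; apply: eq_integrable (integrable_prod (integrable_cst_prob P 1) gi) => //.
by move=> z _ /=; rewrite mul1r.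
Qed.

Lemma Rintegral_snd (g : T2 -> R) : intg Q g ->
  \int[(P \x Q)%E]_z g z.2 = \int[Q]_y g y.
Proof.
move=> gi; have := Rintegral_prod (integrable_cst_prob P 1) gi.
by rewrite Rintegral_prob_cst mul1r => <-; apply: eq_Rintegral => z _; rewrite mul1r.
Qed.

End product.

(** * Integrals against a convolution as integrals over the product measure *)

Section convolution.
Context (R : realType).
Local Notation mR := (measurableTypeR R).
Implicit Types mu nu rho : probability mR R.

Lemma integrable_convolution mu nu (g : mR -> R) : measurable_fun [set: mR] g ->
  intg (mu \x nu)%E (fun z => g (z.1 + z.2)) -> intg (convolution mu nu) g.
Proof.
move=> mg gi; apply/integrableP; split; first exact/measurable_EFinP.
rewrite /convolution ge0_integral_distribution//.
  by have /integrableP[] := gi.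
by do 2 apply: measurableT_comp => //.
Qed.

Lemma Rintegral_convolution mu nu (g : mR -> R) : measurable_fun [set: mR] g ->
  intg (mu \x nu)%E (fun z => g (z.1 + z.2)) ->
  \int[convolution mu nu]_x g x = \int[(mu \x nu)%E]_z g (z.1 + z.2).
Proof.
move=> mg gi; congr fine.
by rewrite /convolution integral_distribution//; exact/measurable_EFinP.
Qed.

End convolution.

(** * Moments of convolution powers and of convolution factors *)

Section moments.
Context (R : realType).
Local Notation mR := (measurableTypeR R).
Implicit Types mu nu rho : probability mR R.

Lemma measurable_pow (i : nat) : measurable_fun [set: mR] (fun x : R => x ^+ i).
Proof. exact: measurable_funX. Qed.

Lemma measurable_convolution_fun (g : R -> R) : measurable_fun [set: mR] g ->
  measurable_fun [set: mR * mR] (fun z => g (z.1 + z.2)).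
Proof. by move=> mg; apply: measurableT_comp => //; exact: measurable_add_pair. Qed.

Lemma norm_pow_le4 (x : R) (i : nat) : (i <= 4)%N -> `|x ^+ i| <= 1 + x ^+ 4.
Proof.
move=> i4; have x40 : 0 <= x ^+ 4 by rewrite exprn_even_ge0.
rewrite normrX; have [x1|x1] := leP `|x| 1.
  by rewrite (@le_trans _ _ 1) ?exprn_ile1// lerDl.
have -> : x ^+ 4 = `|x| ^+ 4 by rewrite -normrX ger0_norm.
by rewrite ler_wpDl// ler_weXn2l// ltW.
Qed.

Lemma integrable_pow mu (i : nat) : (i <= 4)%N ->
  intg mu (fun x : R => x ^+ 4) -> intg mu (fun x : R => x ^+ i).
Proof.
move=> i4 mu4; apply: integrable_le_fun (measurable_pow i) _ _.
  by move=> x; exact: norm_pow_le4.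
exact: integrable_add (integrable_cst_prob mu 1) mu4.
Qed.

Section pair.
Variables (mu nu : probability mR R).
Hypotheses (mu4 : intg mu (fun x : R => x ^+ 4)).
Hypotheses (nu4 : intg nu (fun x : R => x ^+ 4)).
Variable (j : nat).
Hypothesis (j4 : (j <= 4)%N).

Let term (i : 'I_j.+1) (z : mR * mR) : R :=
  'C(j, i)%:R * ((z.1 : R) ^+ (j - i) * (z.2 : R) ^+ i).

Let term_int i : intg (mu \x nu)%E (term i).
Proof.
have ij : (i <= j)%N by rewrite -ltnS.
have i1 : intg mu (fun x : R => x ^+ (j - i)).
  by apply: integrable_pow => //; rewrite (leq_trans _ j4)// leq_subr.
have i2 : intg nu (fun x : R => x ^+ i).
  by apply: integrable_pow => //; exact: leq_trans j4.
exact: integrable_scale (integrable_prod i1 i2).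
Qed.

Let termE (z : mR * mR) : ((z.1 : R) + z.2) ^+ j = \sum_i term i z.
Proof. by rewrite exprDn; apply: eq_bigr => i _; rewrite /term mulr_natl. Qed.

Lemma integrable_add_pow : intg (mu \x nu)%E (fun z => ((z.1 : R) + z.2) ^+ j).
Proof.
apply: eq_integrable (integrable_sumr _ term_int) => // z _ /=.
by rewrite termE.
Qed.

Lemma integrable_convolution_pow : intg (convolution mu nu) (fun x : R => x ^+ j).
Proof. by apply: integrable_convolution integrable_add_pow => //; exact: measurable_pow. Qed.

(** The binomial formula splits (x + y)^j into terms with separated variables, which the product
    measure integrates factor by factor. *)
Lemma moment_convolution : \int[convolution mu nu]_x (x : R) ^+ j =
  \sum_(i < j.+1) 'C(j, i)%:R *
    ((\int[mu]_x (x : R) ^+ (j - i)) * (\int[nu]_x (x : R) ^+ i)).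
Proof.
rewrite (Rintegral_convolution (measurable_pow j) integrable_add_pow).
under eq_Rintegral do rewrite termE.
rewrite Rintegral_sumr; last exact: term_int.
apply: eq_bigr => i _; have ij : (i <= j)%N by rewrite -ltnS.
have i1 : intg mu (fun x : R => x ^+ (j - i)).
  by apply: integrable_pow => //; rewrite (leq_trans _ j4)// leq_subr.
have i2 : intg nu (fun x : R => x ^+ i).
  by apply: integrable_pow => //; exact: leq_trans j4.
rewrite RintegralZl//; last exact: integrable_prod i1 i2.
by rewrite (Rintegral_prod i1 i2).
Qed.

End pair.

Lemma Rintegral_pow0 mu : \int[mu]_x (x : R) ^+ 0 = 1.
Proof. by under eq_Rintegral do rewrite expr0; rewrite Rintegral_prob_cst. Qed.

Lemma integrable_dirac0 rho (f : R -> R) : measurable_fun [set: mR] f ->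
  intg (convolution_pow rho 0) f.
Proof.
move=> mf; apply/integrableP; split; first exact/measurable_EFinP.
rewrite integral_dirac//; last first.
  by apply: measurableT_comp => //; exact/measurable_EFinP.
by rewrite /= diracT mul1e ltry.
Qed.

Lemma Rintegral_dirac0 rho (f : R -> R) : measurable_fun [set: mR] f ->
  \int[convolution_pow rho 0]_x f x = f 0.
Proof.
move=> mf; rewrite /Rintegral integral_dirac//; last exact/measurable_EFinP.
by rewrite diracT mul1e.
Qed.

Section convolution_pow.
Variable (rho : probability mR R).
Hypothesis (rho4 : intg rho (fun x : R => x ^+ 4)).

Lemma integrable_convolution_pow4 n :
  intg (convolution_pow rho n) (fun x : R => x ^+ 4).
Proof.
elim: n => [|n ih]; first exact: integrable_dirac0 (measurable_pow 4).
exact: integrable_convolution_pow.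
Qed.

Lemma mean_convolution_pow n :
  \int[convolution_pow rho n]_x (x : R) ^+ 1 = n%:R * \int[rho]_x (x : R) ^+ 1.
Proof.
elim: n => [|n ih].
  by rewrite (Rintegral_dirac0 _ (measurable_pow 1)) expr1 mul0r.
rewrite [LHS]moment_convolution//; last exact: integrable_convolution_pow4.
rewrite !big_ord_recr big_ord0 /= ih !Rintegral_pow0 -natr1 bin0 binn.
by ring.
Qed.

Hypothesis (rho1 : \int[rho]_x (x : R) ^+ 1 = 0).

Lemma moment2_convolution_pow n :
  \int[convolution_pow rho n]_x (x : R) ^+ 2 = n%:R * \int[rho]_x (x : R) ^+ 2.
Proof.
elim: n => [|n ih].
  by rewrite (Rintegral_dirac0 _ (measurable_pow 2)) mul0r expr0n.
rewrite [LHS]moment_convolution//; last exact: integrable_convolution_pow4.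
rewrite !big_ord_recr big_ord0 /= ih !Rintegral_pow0 -natr1 bin0 binn rho1.
by ring.
Qed.

(** In the binomial expansion the terms of degree 1 in either variable vanish, so a summand added to
    k others contributes its fourth moment plus 6 k times the squared variance; summing 6 k over k <
    n gives 3 n (n - 1). *)
Lemma moment4_convolution_pow n :
  \int[convolution_pow rho n]_x (x : R) ^+ 4 =
    n%:R * \int[rho]_x (x : R) ^+ 4
    + 3 * n%:R * (n%:R - 1) * (\int[rho]_x (x : R) ^+ 2) ^+ 2.
Proof.
elim: n => [|n ih].
  by rewrite (Rintegral_dirac0 _ (measurable_pow 4)) expr0n !(mul0r,mulr0) addr0.
rewrite [LHS]moment_convolution//; last exact: integrable_convolution_pow4.
rewrite !big_ord_recr big_ord0 /= ih moment2_convolution_pow mean_convolution_pow.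
rewrite !Rintegral_pow0 rho1 -natr1 bin0 bin1 binn.
have -> : 'C(4, 2) = 6%N by [].
have -> : 'C(4, 3) = 4%N by [].
by ring.
Qed.

End convolution_pow.

(** By Fubini, (x + y)^4 is [rho]-integrable in x for at least one y, and a translation by a
    constant preserves finiteness of the fourth moment. This is how the summand of a divisible law
    inherits the moment of the sum. *)
Lemma integrable_deconvolution4 rho nu :
  intg (convolution rho nu) (fun x : R => x ^+ 4) -> intg rho (fun x : R => x ^+ 4).
Proof.
move=> /integrableP[_ c4].
have m4 := measurable_convolution_fun (measurable_pow 4).
have prod4 : intg (rho \x nu)%E (fun z => ((z.1 : R) + z.2) ^+ 4).
  apply/integrableP; split; first exact/measurable_EFinP.
  rewrite ge0_integral_distribution// in c4.
  by do 2 apply: measurableT_comp => //; exact: measurable_pow.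
have [y /= yi] : exists y, intg rho (fun x => ((x : R) + y) ^+ 4).
  (* If no y worked, the exceptional set of Fubini's theorem would be the whole line, yet it is null
     for a measure of mass 1. *)
  apply: contrapT => /forallNP noy.
  have [A [mA A0 NA]] := ae_integrable2 prod4.
  have : A = setT by rewrite -subTset => y _; apply: NA => /= /noy.
  move=> AT; move: A0; rewrite AT => /(etrans (esym (probability_setT nu))) /eqP.
  by rewrite onee_eq0.
pose g (x : R) : R := 8 * ((x + (y : R)) ^+ 4 + (y : R) ^+ 4).
apply: (@integrable_le_fun _ _ _ rho (fun x : R => x ^+ 4) g (measurable_pow 4)).
  move=> x; rewrite /g ger0_norm ?exprn_even_ge0//.
  (* With a = x + y and b = y, the difference 8 (a^4 + b^4) - (a - b)^4 is written as a sum of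
     nonnegative terms. *)
  rewrite -subr_ge0 (_ : _ - _ = 4 * ((x + y) ^+ 2 - y ^+ 2) ^+ 2
    + (x + y + y) ^+ 2 * (2 * ((x + y) ^+ 2 + y ^+ 2) + x ^+ 2)); last by ring.
  apply: addr_ge0; apply: mulr_ge0; rewrite ?sqr_ge0//.
  by rewrite addr_ge0 ?sqr_ge0// mulr_ge0// addr_ge0 ?sqr_ge0.
exact: integrable_scale (integrable_add yi (integrable_cst_prob rho _)).
Qed.

End moments.

(** * Exchangeability of the summands *)

Section exchangeability.
Context (R : realType).
Local Notation mR := (measurableTypeR R).
Implicit Types mu nu rho : probability mR R.

Lemma measurable_translate (g : R -> R) (y : R) : measurable_fun [set: mR] g ->
  measurable_fun [set: mR] (fun x => g (y + x)).
Proof. by move=> mg; apply: measurableT_comp => //; exact: measurable_funD. Qed.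

Section translation_average.
Variables (mu : probability mR R) (g : R -> R) (B : R).
Hypotheses (mg : measurable_fun [set: mR] g) (gB : forall x, `|g x| <= B).

Let avg (w : R) : R := \int[mu]_s g (w + s).

Lemma measurable_avg : measurable_fun [set: mR] avg.
Proof.
(* The first factor is an arbitrary choice: the product serves to obtain measurability of the inner
   integral from Fubini's theorem. *)
have gi : intg (mu \x mu)%E (fun z => g ((z.1 : R) + z.2)).
  by apply: integrable_bounded; [exact: measurable_convolution_fun|move=> z; exact: gB].
have /(measurable_int mu) mF := integrable_fubini_F gi.
apply/measurable_EFinP; apply: eq_measurable_fun mF => w _.
rewrite /fubini_F /= EFin_Rintegral//.
by apply: integrable_bounded; [exact: measurable_translate|move=> s; exact: gB].
Qed.

Lemma norm_avg w : `|avg w| <= B.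
Proof.
rewrite -[B](Rintegral_prob_cst mu); apply: Rintegral_le_norm => //.
- exact: measurable_translate.
- exact: integrable_cst_prob.
Qed.

End translation_average.

Section weighted.
Variables (mu nu : probability mR R) (g : R -> R) (B : R).
Hypotheses (mg : measurable_fun [set: mR] g) (gB : forall x, `|g x| <= B).

Lemma integrable_mul_bounded : intg mu (fun x : R => x) -> intg mu (fun x : R => x * g x).
Proof.
move=> mu1.
apply: (@integrable_le_fun _ _ _ mu (fun x : R => x * g x) (fun x : R => B * `|x|)).
- exact: measurable_funM.
- by move=> x; rewrite normrM mulrC ler_wpM2r.
- exact: integrable_scale (integrable_norm mu1).
Qed.

Lemma integrable_fst_mul : intg mu (fun x : R => x) ->
  intg (mu \x nu)%E (fun z => (z.1 : R) * g (z.1 + z.2)).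
Proof.
move=> mu1.
apply: (@integrable_le_fun _ _ _ (mu \x nu)%E (fun z => (z.1 : R) * g (z.1 + z.2))
  (fun z => B * `|(z.1 : R)|)).
- apply: measurable_funM; first exact: measurable_fst.
  exact: measurable_convolution_fun.
- by move=> z; rewrite normrM mulrC ler_wpM2r.
- exact: integrable_scale (integrable_norm (integrable_fst nu mu1)).
Qed.

Lemma integrable_snd_mul : intg nu (fun x : R => x) ->
  intg (mu \x nu)%E (fun z => (z.2 : R) * g (z.1 + z.2)).
Proof.
move=> nu1.
apply: (@integrable_le_fun _ _ _ (mu \x nu)%E (fun z => (z.2 : R) * g (z.1 + z.2))
  (fun z => B * `|(z.2 : R)|)).
- apply: measurable_funM; first exact: measurable_snd.
  exact: measurable_convolution_fun.
- by move=> z; rewrite normrM mulrC ler_wpM2r.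
- exact: integrable_scale (integrable_norm (integrable_snd mu nu1)).
Qed.

Lemma integrable_Rintegral_snd_mul : intg nu (fun x : R => x) ->
  intg mu (fun y : R => \int[nu]_s ((s : R) * g (y + s))).
Proof.
move=> nu1; have si := integrable_snd_mul nu1.
apply: eq_integrable (integrable_fubini_F si) => // y _.
rewrite /fubini_F /= EFin_Rintegral//.
apply: (@le_integrable _ _ _ nu setT measurableT _ (fun s => (B * `|(s : R)|)%:E)).
- apply/measurable_EFinP; apply: measurable_funM => //.
  exact: measurable_translate.
- move=> s _ /=; rewrite lee_fin normrM mulrC.
  by rewrite [leRHS]ger0_norm ?ler_wpM2r// mulr_ge0// (le_trans _ (gB 0)).
- exact: integrable_scale (integrable_norm nu1).
Qed.

End weighted.

(** The factor x of the integrand is shared between the two summands. The second share is kept as an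
    iterated integral, whose inner part has the original shape for a translate of [g], ready for an
    induction. *)
Lemma Rintegral_convolution_mul mu nu (g : R -> R) (B : R) :
  measurable_fun [set: mR] g -> (forall x, `|g x| <= B) ->
  intg mu (fun x : R => x) -> intg nu (fun x : R => x) ->
  \int[convolution mu nu]_x ((x : R) * g x) =
    \int[(mu \x nu)%E]_z ((z.1 : R) * g (z.1 + z.2)) +
    \int[mu]_y \int[nu]_s ((s : R) * g (y + s)).
Proof.
move=> mg gB mu1 nu1.
have i1 := integrable_fst_mul nu mg gB mu1.
have i2 := integrable_snd_mul mu mg gB nu1.
rewrite (@Rintegral_convolution _ mu nu (fun x : R => x * g x)).
- under eq_Rintegral do rewrite mulrDl.
  rewrite RintegralD//; congr (_ + _); apply: Rintegral_prod12 => // y.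
  by apply: integrable_mul_bounded => //; exact: measurable_translate.
- exact: measurable_funM.
- by apply: eq_integrable (integrable_add i1 i2) => // z _ /=; rewrite mulrDl.
Qed.

(** Both sides are E[Y g(Y + Y' + S')] for independent Y, Y' of law [rho] and S' of law [nu]: on the
    left Y' is the outermost variable, on the right it is absorbed in the convolution. Averaging
    over S' turns [g] into a bounded function [G] and leaves a swap of two variables. *)
Lemma Rintegral_triple_swap rho nu (g : R -> R) (B : R) :
  measurable_fun [set: mR] g -> (forall x, `|g x| <= B) ->
  intg rho (fun x : R => x) ->
  \int[rho]_y \int[(rho \x nu)%E]_z ((z.1 : R) * g (y + (z.1 + z.2))) =
  \int[(rho \x convolution rho nu)%E]_z ((z.1 : R) * g (z.1 + z.2)).
Proof.
move=> mg gB rho1; pose G (w : R) : R := \int[nu]_s g (w + s).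
have mG : measurable_fun [set: mR] G by exact: measurable_avg mg gB.
have GB w : `|G w| <= B by exact: norm_avg.
have bi (P : probability mR R) (f : R -> R) : measurable_fun [set: mR] f ->
    (forall x, `|f x| <= B) -> intg P f by exact: integrable_bounded.
have gi y : intg nu (fun s : R => g (y + s)).
  by apply: bi => //; exact: measurable_translate.
have Gi y : intg rho (fun s : R => G (y + s)).
  by apply: bi => //; exact: measurable_translate.
transitivity (\int[rho]_y \int[rho]_x ((x : R) * G (y + x))).
  apply: eq_Rintegral => y _; rewrite Rintegral_prod12.
  - apply: eq_Rintegral => x _ /=; rewrite -RintegralZl//.
    by apply: eq_Rintegral => s _; rewrite addrA.
  - by apply: (@integrable_fst_mul _ _ (fun x => g (y + x)) B) => //; exact: measurable_translate.
  - move=> x /=; apply: integrable_scale.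
    by apply: eq_integrable (gi (y + x)) => // s _ /=; rewrite addrA.
transitivity (\int[rho]_x \int[rho]_y ((x : R) * G (x + y))); last first.
  rewrite Rintegral_prod12/=.
  - apply: eq_Rintegral => x _ /=; rewrite RintegralZl// RintegralZl//; last first.
      by apply: bi => //; exact: measurable_translate.
    congr (_ * _).
    rewrite (@Rintegral_convolution _ rho nu (fun s => g (x + s))).
    + rewrite Rintegral_prod12.
      * by apply: eq_Rintegral => y _; apply: eq_Rintegral => s _; rewrite addrA.
      * apply: integrable_bounded => [|z]; last exact: gB.
        by apply: (@measurable_convolution_fun _ (fun w => g (x + w))); exact: measurable_translate.
      * by move=> y; apply: eq_integrable (gi (x + y)) => // s _ /=; rewrite addrA.
    + exact: measurable_translate.
    + apply: integrable_bounded => [|z]; last exact: gB.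
      by apply: (@measurable_convolution_fun _ (fun w => g (x + w))); exact: measurable_translate.
  - exact: integrable_fst_mul mg gB rho1.
  - move=> x /=; apply: integrable_scale.
    by apply: bi => //; exact: measurable_translate.
(* The swap itself: one integral over [rho \x rho] is read in both orders. *)
rewrite -(@Rintegral_prod12 _ _ _ _ _ rho rho (fun z => (z.2 : R) * G (z.1 + z.2))).
- rewrite (@Rintegral_prod21 _ _ _ _ _ rho rho (fun z => (z.2 : R) * G (z.1 + z.2))).
  + by apply: eq_Rintegral => x _; apply: eq_Rintegral => y _ /=; rewrite addrC.
  + exact: integrable_snd_mul mG GB rho1.
  + move=> y /=; apply: integrable_scale.
    by apply: eq_integrable (Gi y) => // s _ /=; rewrite addrC.
- exact: integrable_snd_mul mG GB rho1.
- move=> y /=; apply: (@integrable_mul_bounded _ (fun x => G (y + x)) B) => //.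
  exact: measurable_translate.
Qed.

(* The n.+1 summands are exchangeable, so E[S g(S)] is n.+1 times the
   contribution of the first one. *)
Lemma Rintegral_convolution_pow_mul rho n (g : R -> R) (B : R) :
  measurable_fun [set: mR] g -> (forall x, `|g x| <= B) ->
  intg rho (fun x : R => x ^+ 4) ->
  \int[convolution_pow rho n.+1]_x ((x : R) * g x) =
  n.+1%:R * \int[(rho \x convolution_pow rho n)%E]_z ((z.1 : R) * g (z.1 + z.2)).
Proof.
move=> + + rho4; have i1 k : intg (convolution_pow rho k) (fun x : R => x).
  exact: (@integrable_pow _ _ 1 isT (integrable_convolution_pow4 rho4 k)).
have rho1 : intg rho (fun x : R => x) by exact: (@integrable_pow _ _ 1).
have step k (f : R -> R) : measurable_fun [set: mR] f -> (forall x, `|f x| <= B) ->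
    \int[convolution_pow rho k.+1]_x ((x : R) * f x) =
    \int[(rho \x convolution_pow rho k)%E]_z ((z.1 : R) * f (z.1 + z.2)) +
    \int[rho]_y \int[convolution_pow rho k]_s ((s : R) * f (y + s)).
  by move=> mg gB; exact: Rintegral_convolution_mul mg gB rho1 (i1 k).
(* [g] is generalised because the induction hypothesis is applied to its translates g(y + .), which
   obey the same bound [B]. *)
elim: n g => [|n ih] g mg gB; rewrite step//.
  rewrite mul1r -[RHS]addr0; congr (_ + _).
  rewrite -[RHS](Rintegral_prob_cst rho); apply: eq_Rintegral => y _.
  rewrite (@Rintegral_dirac0 _ rho (fun s => s * g (y + s))) ?mul0r//.
  by apply: measurable_funM => //; exact: measurable_translate.
have ihE y : \int[convolution_pow rho n.+1]_s ((s : R) * g (y + s)) =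
    n.+1%:R * \int[(rho \x convolution_pow rho n)%E]_z ((z.1 : R) * g (y + (z.1 + z.2))).
  by rewrite (ih (fun s => g (y + s)))//; exact: measurable_translate.
have Fi := integrable_Rintegral_snd_mul rho mg gB (i1 n.+1).
rewrite -[n.+2%:R]nat1r mulrDl mul1r; congr (_ + _).
rewrite -(Rintegral_triple_swap _ mg gB rho1) -RintegralZl//.
  by apply: eq_Rintegral => y _; exact: ihE.
apply: eq_integrable (integrable_scale n.+1%:R^-1 Fi) => // y _ /=.
by rewrite ihE mulKf.
Qed.

End exchangeability.

(** * Gaussian density, Gaussian tail and Stein's equation *)

Section standard_normal.
Context (R : realType).
Local Notation mR := (measurableTypeR R).
Local Notation lebesgue := (@lebesgue_measure R).
Local Notation phi := (@normal_pdf R 0 1).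

Let peak : R := normal_peak 1.

Let peak_gt0 : 0 < peak.
Proof. by apply: normal_peak_gt0; exact: oner_neq0. Qed.

Lemma normal_pdf01E (x : R) : phi x = normal_peak 1 * expR (- x ^+ 2 / 2).
Proof.
by rewrite normal_pdfE ?oner_neq0//= /normal_fun subr0 expr1n.
Qed.

Lemma normal_pdf01_gt0 (x : R) : 0 < phi x.
Proof. by rewrite normal_pdf01E mulr_gt0// expR_gt0. Qed.

Lemma normal_pdf01_even (x : R) : phi (- x) = phi x.
Proof. by rewrite !normal_pdf01E sqrrN. Qed.

Lemma normal_pdf01_ge1 (x : R) : `|x| <= 1 -> phi 1 <= phi x.
Proof.
move=> x1; rewrite !normal_pdf01E ler_wpM2l ?(ltW peak_gt0)// ler_expR.
rewrite ler_wpM2r// lerN2 expr1n -real_normK ?num_real//.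
exact: exprn_ile1.
Qed.

Lemma continuous_normal_pdf01 : continuous phi.
Proof. by apply: continuous_normal_pdf; exact: oner_neq0. Qed.

Lemma is_derive_normal_pdf01 (x : R) : is_derive x 1 phi (- (x * phi x)).
Proof.
have -> : phi = (fun y => normal_peak 1 * expR (- y ^+ 2 / 2)).
  by apply/funext => y; exact: normal_pdf01E.
apply: is_derive_eq.
rewrite /GRing.scale /=.
by field.
Qed.

Lemma cvg_normal_pdf01 : phi x @[x --> +oo] --> 0.
Proof.
have -> : (phi : R -> R) = (fun y => normal_peak 1 * gauss_fun (y / Num.sqrt 2)).
  apply/funext => y; rewrite normal_pdf01E /gauss_fun; congr (_ * expR _).
  by rewrite expr_div_n sqr_sqrtr// mulNr.
rewrite -(mulr0 (normal_peak 1)); apply: cvgM; first exact: cvg_cst.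
apply: (cvg_comp (fun y : R => y / Num.sqrt 2) (@gauss_fun R)); last exact: cvg_gauss_fun.
by apply: gt0_cvgMly => //; rewrite invr_gt0 sqrtr_gt0.
Qed.

(** The change of variables holds for a Radon-Nikodym derivative, which agrees almost everywhere
    with the density because both integrate to the measure of every measurable set. *)
Lemma Rintegral_normal_prob (m s : R) (f : R -> R) :
  intg (normal_prob m s) f ->
  \int[normal_prob m s]_x f x = \int[lebesgue]_x (f x * normal_pdf m s x).
Proof.
move=> fi; have mf := integrable_measurable fi.
congr fine; rewrite -(Radon_Nikodym_change_of_variables (normal_prob_dominates m s))//=.
apply: ae_eq_integral => //.
- apply: emeasurable_funM; first exact/measurable_EFinP.
  apply: (measurable_int lebesgue); apply: Radon_Nikodym_integrable.
  exact: normal_prob_dominates.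
- apply/measurable_EFinP; apply: measurable_funM => //; exact: measurable_normal_pdf.
- under [X in ae_eq _ _ _ X]eq_fun do rewrite EFinM.
  apply: ae_eqe_mul2l; rewrite Radon_NikodymE//=; first exact: normal_prob_dominates.
  move=> numu; case: cid => /= h [h1 h2 h3].
  apply: integral_ae_eq => //=.
  + apply/measurable_EFinP; exact: measurable_normal_pdf.
  + by move=> E E01 mE; rewrite -h3.
Qed.

Lemma integrable_normal_pdf01 (A : set mR) : measurable A ->
  lebesgue.-integrable A (EFin \o phi).
Proof.
by move=> mA; apply: (integrableS measurableT) => //; exact: integrable_normal_pdf.
Qed.

Lemma integrable_mul_normal_pdf01 (A : set mR) (f : R -> R) (B : R) :
  measurable A -> measurable_fun [set: mR] f -> (forall x, `|f x| <= B) ->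
  lebesgue.-integrable A (EFin \o (fun x => f x * phi x)).
Proof.
move=> mA mf fB; apply: (integrableS measurableT) => //.
apply: (@integrable_le_fun _ _ _ lebesgue (fun x => f x * phi x) (fun x => B * phi x)).
- by apply: measurable_funM => //; exact: measurable_normal_pdf.
- by move=> x; rewrite normrM (gtr0_norm (normal_pdf01_gt0 x)) ler_wpM2r ?normal_pdf_ge0.
- by apply: integrable_scale; exact: integrable_normal_pdf01.
Qed.

Let tail (x : R) : R := \int[lebesgue]_(t in `[x, +oo[) phi t.

Lemma Rintegral_normal_pdf01 : \int[lebesgue]_x phi x = 1.
Proof. by rewrite /Rintegral integral_normal_pdf. Qed.

Lemma normal_tail_le1 (x : R) : tail x <= 1.
Proof.
rewrite -Rintegral_normal_pdf01 /tail Rintegral_mkcond.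
apply: le_Rintegral => //.
- rewrite -restrict_EFin; apply/integrable_restrict => //=; rewrite setTI.
  exact: integrable_normal_pdf01.
- exact: integrable_normal_pdf01.
- by move=> t _; rewrite patchE; case: ifP => // _; exact: normal_pdf_ge0.
Qed.

Lemma normal_lower_tail (x : R) :
  \int[lebesgue]_(t in `]-oo, - x]) phi t = tail x.
Proof.
congr fine; rewrite ge0_integration_by_substitutionNy//.
- by apply: eq_integral => t _ /=; rewrite normal_pdf01_even.
- exact/continuous_subspaceT/continuous_normal_pdf01.
- by move=> t _; exact: normal_pdf_ge0.
Qed.

(** On [[x, +oo[] the weight x is at most t, and t phi(t) has the antiderivative - phi(t), which
    vanishes at infinity. *)
Lemma mills_ratio (x : R) : 0 <= x -> x * tail x <= phi x.
Proof.
move=> x0.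
have FTC : (\int[lebesgue]_(t in `[x, +oo[) (t * phi t)%:E = (0 : R)%:E - (- phi x)%:E)%E.
  apply: (@ge0_continuous_FTC2y _ (fun t => t * phi t) (fun t => - phi t)).
  - by move=> t xt; rewrite mulr_ge0 ?normal_pdf_ge0// (le_trans x0).
  - apply: continuous_subspaceT => t; apply: cvgM; first exact: cvg_id.
    exact: continuous_normal_pdf01.
  - by have := cvgN cvg_normal_pdf01; rewrite oppr0; exact.
  - by move=> t _; apply: derivableN; have [] := is_derive_normal_pdf01 t.
  - apply: cvg_at_right_filter; apply: cvgN; exact: continuous_normal_pdf01.
  - move=> t _; rewrite derive1E; have := is_derive_normal_pdf01 t => dphi.
    by rewrite deriveN// derive_val opprK.
rewrite -lee_fin.
have -> : (phi x)%:E = (\int[lebesgue]_(t in `[x, +oo[) (t * phi t)%:E)%E.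
  by rewrite FTC -EFinB opprK add0r.
rewrite EFinM fineK; last first.
  by apply: integrable_fin_num => //; exact: integrable_normal_pdf01.
rewrite -ge0_integralZl//.
- apply: ge0_le_integral => //.
  + by move=> t _; rewrite mule_ge0// lee_fin normal_pdf_ge0.
  + apply: measurable_funTS; apply/measurable_EFinP.
    by apply: measurable_funM => //; exact: measurable_normal_pdf.
  + apply: measurable_funTS; apply/measurable_EFinP.
    by apply: measurable_funM => //; exact: measurable_normal_pdf.
  + by move=> t; rewrite /= in_itv/= andbT => xt; rewrite lee_fin ler_wpM2r ?normal_pdf_ge0.
- by apply: measurable_funTS; apply/measurable_EFinP; exact: measurable_normal_pdf.
- by move=> t _; rewrite lee_fin normal_pdf_ge0.
Qed.

(* The solution is F / phi, where F x integrates (h - c) phi over ]-oo, x]; as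
   (h - c) phi has total mass zero, F is controlled by the Gaussian tail on
   both sides. *)
Lemma stein_equation_solution (h : R -> R) (B : R) :
  continuous h -> (forall x, `|h x| <= B) ->
  exists f : R -> R, exists A : R, [/\
    forall x : R, is_derive x 1 f (x * f x + (h x - \int[normal_prob 0 1]_y h y)),
    forall x, `|f x| <= A & forall x, `|x * f x| <= A].
Proof.
move=> ch hB; pose c : R := \int[@normal_prob R 0 1]_y h y.
have mh : measurable_fun [set: mR] h by exact: continuous_measurable_fun.
have hi : intg (@normal_prob R 0 1) h by exact: integrable_bounded.
have B0 : 0 <= B by rewrite (le_trans _ (hB 0)).
have cB : `|c| <= B.
  rewrite -[B](Rintegral_prob_cst (@normal_prob R 0 1)); apply: Rintegral_le_norm => //.
  exact: integrable_cst_prob.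
pose k (x : R) : R := h x - c.
have kB x : `|k x| <= 2 * B.
  by rewrite (le_trans (ler_normB _ _))// mulr_natl mulr2n lerD.
have mk : measurable_fun [set: mR] k by exact: measurable_funB.
pose g (x : R) : R := k x * phi x.
have gi (A : set mR) : measurable A -> lebesgue.-integrable A (EFin \o g).
  by move=> mA; exact: integrable_mul_normal_pdf01 mk kB.
have cg : continuous g.
  move=> x; apply: cvgM; last exact: continuous_normal_pdf01.
  by apply: cvgB; [exact: ch|exact: cvg_cst].
pose F (x : R) : R := \int[lebesgue]_(t in `]-oo, x]) g t.
have dF (x : R) : is_derive x 1 F (g x).
  (* The endpoint x + 1 puts x in the interior of the interval of integrability; any larger number
     than x would do. *)
  have [|||] := @continuous_FTC1 R g -oo%O x (x + 1) _ (gi _ _) _ (cg x) => //.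
    by rewrite ltrDl.
  - exact: ltNyr.
  by move=> dF <-; rewrite derive1E; exact/derivableP.
have gT : \int[lebesgue]_x g x = 0.
  rewrite /g /k; under eq_Rintegral do rewrite mulrBl.
  rewrite RintegralB//; last 2 first.
    exact: integrable_mul_normal_pdf01 mh hB.
    exact: integrable_scale (integrable_normal_pdf01 measurableT).
  rewrite RintegralZl//; last exact: integrable_normal_pdf01.
  by rewrite Rintegral_normal_pdf01 mulr1 -Rintegral_normal_prob// subrr.
have gA (A : set mR) : measurable A ->
    `|\int[lebesgue]_(t in A) g t| <= 2 * B * \int[lebesgue]_(t in A) phi t.
  move=> mA; rewrite -RintegralZl//; last exact: integrable_normal_pdf01.
  apply: (le_trans (le_normr_Rintegral mA (gi _ mA))); apply: le_Rintegral => //.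
  - by apply: integrable_norm; exact: gi.
  - by apply: eq_integrable (integrableZl mA (2 * B) (integrable_normal_pdf01 mA)).
  - move=> x _; rewrite normrM (gtr0_norm (normal_pdf01_gt0 x)).
    by rewrite ler_wpM2r ?normal_pdf_ge0.
have FE x : F x = - \int[lebesgue]_(t in `]x, +oo[) g t.
  have gNyy : lebesgue.-integrable [set` `]-oo, +oo[] (EFin \o g) by exact: gi.
  have <- := @Rintegral_itvB R g -oo%O +oo%O x gNyy isT isT.
  by rewrite set_itvNyy gT sub0r opprK.
have Ftail x : `|F x| <= 2 * B * tail `|x|.
  have [x0|x0] := leP 0 x.
    rewrite FE normrN; apply: (le_trans (gA _ _)) => //.
    rewrite (Rintegral_itv_obnd_cbnd (integrable_normal_pdf01 _))//.
    by rewrite (ger0_norm x0).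
  by rewrite (ltr0_norm x0) -normal_lower_tail opprK; exact: gA.
(* This is F / phi, with 1 / phi spelled out as an exponential so that the derivative can be
   computed by instance resolution. *)
pose f (x : R) : R := F x * (peak^-1 * expR (x ^+ 2 / 2)).
have phiV x : peak^-1 * expR (x ^+ 2 / 2) = (phi x)^-1.
  rewrite normal_pdf01E mulNr expRN invfM. congr (_ * _).
  by rewrite invrK.
(* The Mills bound at |x| absorbs the factor x: |x| times the tail at |x| is at most phi(x). *)
have xf x : `|x * f x| <= 2 * B.
  rewrite /f phiV mulrA normrM normfV (gtr0_norm (normal_pdf01_gt0 x)).
  rewrite ler_pdivrMr ?normal_pdf01_gt0// normrM.
  rewrite (le_trans (ler_wpM2l _ (Ftail x)))// mulrCA ler_wpM2l ?mulr_ge0//.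
  rewrite (le_trans (mills_ratio _))//.
  by have [x0|x0] := leP 0 x; rewrite ?(ger0_norm x0)// (ltr0_norm x0) normal_pdf01_even.
(* For |x| <= 1 the tail is at most 1 and phi(x) at least phi(1), whence 2B / phi(1); for |x| > 1
   the bound 2B on |x f(x)| also bounds |f(x)|. *)
exists f; exists (2 * B + 2 * B / phi 1); split => x.
- have -> : x * f x + (h x - c) =
      F x * (peak^-1 * (x * expR (x ^+ 2 / 2))) + (phi x)^-1 * g x.
    have phi0 : phi x != 0 by rewrite gt_eqF// normal_pdf01_gt0.
    by rewrite /f /g (mulrCA (phi x)^-1) (mulVf phi0) mulr1 /k; ring.
  rewrite -phiV; apply: is_derive_eq.
  rewrite /GRing.scale /=. by move: peak^-1 => p; field.
- have [x1|x1] := leP `|x| 1.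
    rewrite (@le_trans _ _ (2 * B / phi 1))// ?lerDr ?mulr_ge0//.
    rewrite /f phiV normrM normfV (gtr0_norm (normal_pdf01_gt0 x)).
    rewrite ler_pM// ?invr_ge0 ?normal_pdf_ge0//.
      rewrite (le_trans (Ftail x))// -[leRHS]mulr1 ler_wpM2l ?mulr_ge0//.
      exact: normal_tail_le1.
    by rewrite lef_pV2 ?posrE ?normal_pdf01_gt0//; exact: normal_pdf01_ge1.
  rewrite (@le_trans _ _ (2 * B))// ?lerDl ?divr_ge0 ?mulr_ge0 ?normal_pdf_ge0//.
  by rewrite (le_trans _ (xf x))// [leRHS]normrM ler_peMl// ltW.
- by rewrite (le_trans (xf x))// lerDl divr_ge0 ?mulr_ge0 ?normal_pdf_ge0.
Qed.

End standard_normal.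

(** * Stein's bound for sums of independent identically distributed variables *)

Section stein_bound.
Context (R : realType).
Local Notation mR := (measurableTypeR R).
Implicit Types mu nu rho : probability mR R.

Lemma dist_le_cst_ge0 (h : R -> R) (K : R) :
  (forall x y, `|h x - h y| <= K * `|x - y|) -> 0 <= K.
Proof. by move=> hK; have := le_trans _ (hK 1 0); rewrite subr0 normr1 mulr1; apply. Qed.

Lemma dist_le_continuous (h : R -> R) (K : R) :
  (forall x y, `|h x - h y| <= K * `|x - y|) -> continuous h.
Proof.
move=> hK x; apply/cvgrPdist_le => e e0.
have K0 := dist_le_cst_ge0 hK.
(* [K] may be zero, so K + 1 is the constant to divide by. *)
have K1 : 0 < K + 1 by rewrite ltr_wpDl.
near=> y; rewrite (le_trans (hK _ _))//.
rewrite (@le_trans _ _ ((K + 1) * `|x - y|))// ?ler_wpM2r ?lerDl//.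
rewrite mulrC -ler_pdivlMr//; near: y.
by apply: (@cvgr_dist_le _ _ _ _ _ id); [exact: cvg_id|exact: divr_gt0].
Unshelve. all: by end_near. Qed.

Lemma mean_value_between (f df : R -> R) (u v : R) :
  (forall x : R, is_derive x 1 f (df x)) ->
  exists2 w, `|w - u| <= `|v - u| & f v - f u = df w * (v - u).
Proof.
move=> fdf.
have cf (a b : R) : {within `[a, b], continuous f}.
  by apply: derivable_within_continuous => x _; have [] := fdf x.
have [uv|vu|->] := ltgtP u v.
- have [w] := MVT uv (fun x _ => fdf x) (cf u v).
  rewrite in_itv/= => /andP[uw wv] ->; exists w => //.
  by rewrite !ger0_norm; lra.
- have [w] := MVT vu (fun x _ => fdf x) (cf v u).
  rewrite in_itv/= => /andP[vw wu] E; exists w.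
    by rewrite !ler0_norm; lra.
  by rewrite -opprB E -mulrN opprB.
- by exists v; rewrite ?subrr ?mulr0.
Qed.

(** The square of t - |x| is nonnegative. The weight t stays free and serves E|Y| as well as, after
    multiplication by x^2, E|Y|^3. *)
Lemma norm_le_sqr (t x : R) : 0 < t -> `|x| <= 2^-1 * (t + t^-1 * x ^+ 2).
Proof.
move=> t0; rewrite -subr_ge0 -(real_normK (num_real x)).
have -> : 2^-1 * (t + t^-1 * `|x| ^+ 2) - `|x| = 2^-1 * t^-1 * (t - `|x|) ^+ 2.
  by field; rewrite gt_eqF.
by rewrite mulr_ge0 ?sqr_ge0// mulr_ge0// invr_ge0 ltW.
Qed.

Lemma norm_cube_le (t x : R) : 0 < t ->
  `|x| ^+ 3 <= 2^-1 * (t * x ^+ 2 + t^-1 * x ^+ 4).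
Proof.
move=> t0; have := ler_wpM2l (sqr_ge0 x) (norm_le_sqr x t0).
rewrite -{1}(real_normK (num_real x)) -exprSr => /le_trans; apply.
by rewrite le_eqVlt; apply/orP; left; apply/eqP; field; rewrite gt_eqF.
Qed.

Section solution.
Variables (h f : R -> R) (A B K c : R).
Hypothesis hB : forall x, `|h x| <= B.
Hypothesis cB : `|c| <= B.
Hypothesis hK : forall x y, `|h x - h y| <= K * `|x - y|.
Let df (x : R) : R := x * f x + (h x - c).
Hypothesis fdf : forall x : R, is_derive x 1 f (df x).
Hypothesis fA : forall x, `|f x| <= A.
Hypothesis xfA : forall x, `|x * f x| <= A.

Let D : R := A + 2 * B.
Let L : R := A + D + K.

Let A0 : 0 <= A. Proof. exact: le_trans (fA 0). Qed.
Let B0 : 0 <= B. Proof. exact: le_trans (hB 0). Qed.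
Let K0 : 0 <= K.
Proof. exact: dist_le_cst_ge0 hK. Qed.
Let D0 : 0 <= D. Proof. by rewrite addr_ge0// mulr_ge0. Qed.

Let L0 : 0 <= L. Proof. exact: addr_ge0 (addr_ge0 A0 D0) K0. Qed.

Lemma stein_derive_bound (x : R) : `|df x| <= D.
Proof.
rewrite (le_trans (ler_normD _ _))// lerD//.
by rewrite (le_trans (ler_normB _ _))// mulr_natl mulr2n lerD.
Qed.

(** Stein's equation splits f'(u) - f'(v) into f(u) (u - v), v (f(u) - f(v)) and h(u) - h(v). The
    mean value theorem bounds the middle part by D |u - v| |v|, which is the origin of the factor 1
    + |v|. *)
Lemma stein_derive_lipschitz (u v : R) :
  `|df u - df v| <= L * `|u - v| * (1 + `|v|).
Proof.
have [w _ fuv] := mean_value_between v u fdf.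
have -> : df u - df v = f u * (u - v) + df w * (u - v) * v + (h u - h v).
  by rewrite -fuv /df; ring.
rewrite (le_trans (ler_normD _ _))//.
have h1 : `|f u * (u - v)| <= A * `|u - v| by rewrite normrM ler_wpM2r.
have h2 : `|df w * (u - v) * v| <= D * `|u - v| * `|v|.
  by rewrite !normrM !ler_wpM2r//; exact: stein_derive_bound.
have h3 := ler_normD (f u * (u - v)) (df w * (u - v) * v); have h4 := hK u v.
have p1 : 0 <= A * `|u - v| * `|v| by rewrite !mulr_ge0.
have p2 : 0 <= D * `|u - v| by rewrite mulr_ge0.
have p3 : 0 <= K * `|u - v| * `|v| by rewrite !mulr_ge0.
rewrite /L; lra.
Qed.

(** By the mean value theorem the remainder is y (f'(w) - f'(s)) with w within |y| of s. The growth
    factor sits at s rather than at w, so it separates from y under a product measure. *)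
Lemma stein_taylor (s y : R) :
  `|f (s + y) - f s - y * df s| <= L * y ^+ 2 * (1 + `|s|).
Proof.
have [w ws ->] := mean_value_between s (s + y) fdf.
rewrite addrAC subrr add0r in ws *.
rewrite mulrC -mulrBr normrM -(real_normK (num_real y)) expr2.
rewrite (_ : L * _ * _ = `|y| * (L * `|y| * (1 + `|s|))); last by ring.
rewrite ler_wpM2l// (le_trans (stein_derive_lipschitz _ _))//.
by rewrite ler_wpM2r ?addr_ge0// ler_wpM2l.
Qed.

Let mh : measurable_fun [set: mR] h.
Proof. by apply: continuous_measurable_fun; exact: dist_le_continuous hK. Qed.

Let mf : measurable_fun [set: mR] f.
Proof.
apply: continuous_measurable_fun => x.
by apply/differentiable_continuous/derivable1_diffP; have [] := fdf x.
Qed.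

Let mdf : measurable_fun [set: mR] df.
Proof.
by apply: measurable_funD; [exact: measurable_funM|exact: measurable_funB].
Qed.

Variables (rho : probability mR R) (n : nat).
Hypothesis rho4 : intg rho (fun x : R => x ^+ 4).
Hypothesis rho_mean : \int[rho]_x (x : R) ^+ 1 = 0.
Hypothesis rho_var : n.+1%:R * \int[rho]_x (x : R) ^+ 2 = 1.

Let nu := convolution_pow rho n.

Let nu4 : intg nu (fun x : R => x ^+ 4).
Proof. exact: integrable_convolution_pow4. Qed.

Let rho_i i : (i <= 4)%N -> intg rho (fun x : R => x ^+ i).
Proof. by move=> i4; exact: integrable_pow. Qed.

(** Stein's equation makes the left side E[f'(S)] - E[S f(S)], and exchangeability turns E[S f(S)]
    into (n + 1) E[Y f(Y + S')]. Subtracting Y f(S'), of mean zero, and Y^2 f'(S'), whose mean times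
    n + 1 is E[f'(S')], leaves two Taylor errors. *)
Lemma stein_identity : \int[convolution_pow rho n.+1]_x h x - c =
  \int[(rho \x nu)%E]_z (df (z.1 + z.2) - df z.2) -
  n.+1%:R * \int[(rho \x nu)%E]_z
     ((z.1 : R) * (f (z.2 + z.1) - f z.2 - (z.1 : R) * df z.2)).
Proof.
have dfi (P : probability mR R) : intg P df.
  exact: integrable_bounded mdf stein_derive_bound.
have S1 : intg (convolution_pow rho n.+1) (fun x : R => x).
  exact: (@integrable_pow _ _ 1 isT (integrable_convolution_pow4 rho4 _)).
have rho1 : intg rho (fun x : R => x) by exact: (rho_i (i := 1)).
have fi : intg nu f by exact: integrable_bounded mf fA.
have dSi : intg (rho \x nu)%E (fun z => df (z.1 + z.2)).
  apply: integrable_bounded => [|z]; last exact: stein_derive_bound.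
  exact: measurable_convolution_fun.
have zfi := integrable_fst_mul nu mf fA rho1.
have zf2i := integrable_prod rho1 fi.
have z2fi := integrable_prod (rho_i (i := 2) isT) (dfi nu).
rewrite RintegralB//; last exact: integrable_snd.
rewrite Rintegral_snd//.
have -> : \int[(rho \x nu)%E]_z
     ((z.1 : R) * (f (z.2 + z.1) - f z.2 - (z.1 : R) * df z.2)) =
    \int[(rho \x nu)%E]_z ((z.1 : R) * f (z.1 + z.2))
    - (\int[rho]_x (x : R) ^+ 1) * (\int[nu]_x f x)
    - (\int[rho]_x (x : R) ^+ 2) * (\int[nu]_x df x).
  rewrite -(Rintegral_prod rho1 fi) -(Rintegral_prod (rho_i (i := 2) isT) (dfi nu)).
  rewrite -RintegralB// -RintegralB//; last exact: integrable_sub.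
  by apply: eq_Rintegral => z _ /=; rewrite [(z.2 : R) + _]addrC; ring.
rewrite rho_mean mul0r subr0 mulrBr mulrA rho_var mul1r.
rewrite -(Rintegral_convolution_pow_mul n mf fA rho4).
have -> : \int[convolution_pow rho n.+1]_x h x - c =
    \int[convolution_pow rho n.+1]_x (df x - x * f x).
  rewrite -[X in _ - X](Rintegral_prob_cst (convolution_pow rho n.+1)).
  rewrite -RintegralB//; last 2 first.
    exact: integrable_bounded mh hB.
    exact: integrable_cst_prob.
  by apply: eq_Rintegral => x _; rewrite /df; ring.
rewrite RintegralB//; [|exact: dfi|exact: integrable_mul_bounded mf fA S1].
rewrite [X in X - _ = _](_ : _ = \int[(rho \x nu)%E]_z df (z.1 + z.2)).
  by ring.
exact: Rintegral_convolution.
Qed.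

Lemma stein_estimate (t : R) : 0 < t ->
  `|\int[convolution_pow rho n.+1]_x h x - c| <=
  L * (2 * t + (n.+1%:R * \int[rho]_x (x : R) ^+ 4 + n.+1%:R^-1) / t).
Proof.
move=> t0; set m4 := \int[rho]_x (x : R) ^+ 4.
have t'0 : 0 < t^-1 by rewrite invr_gt0.
pose s2 := \int[rho]_x (x : R) ^+ 2; have s2v : n.+1%:R * s2 = 1 by exact: rho_var.
have s2E : s2 = n.+1%:R^-1.
  by rewrite -[s2](mulKf (_ : n.+1%:R != 0)) ?s2v ?mulr1.
have n0 : 0 <= n.+1%:R :> R by [].
have bnd_abs (P : probability mR R) (a : R) : 0 < a ->
    intg P (fun x : R => x ^+ 4) ->
    \int[P]_x `|(x : R)| <= 2^-1 * (a + a^-1 * \int[P]_x (x : R) ^+ 2).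
  move=> a0 P4; have P2 := @integrable_pow _ _ 2 isT P4.
  have P1 := @integrable_pow _ _ 1 isT P4.
  rewrite -[X in _ * (X + _)](Rintegral_prob_cst P) -RintegralZl// -RintegralD//; last 2 first.
    exact: integrable_cst_prob.
    exact: integrable_scale.
  have P3 := integrable_add (integrable_cst_prob P a) (integrable_scale a^-1 P2).
  rewrite -RintegralZl//; apply: le_Rintegral => //.
  - exact: (integrable_norm P1).
  - exact: integrable_scale.
  - by move=> x _; exact: norm_le_sqr.
(* S' has variance n / (n + 1), at most 1, so the weight 1 is enough here. *)
have nu_abs : \int[nu]_x `|(x : R)| <= 1.
  rewrite (le_trans (bnd_abs nu 1 ltr01 nu4))// invr1 mul1r.
  rewrite moment2_convolution_pow// -/s2 s2E.
  have : n%:R / n.+1%:R <= 1 :> R by rewrite ler_pdivrMr// mul1r ler_nat.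
  by move: (n%:R / _) => r; lra.
have rho_abs : \int[rho]_x `|(x : R)| <= 2^-1 * (t + t^-1 * s2) by exact: bnd_abs.
have rho_cube : \int[rho]_x (`|(x : R)| ^+ 3) <= 2^-1 * (t * s2 + t^-1 * m4).
  have P2 := rho_i (i := 2) isT; have P3 := rho_i (i := 3) isT.
  rewrite -RintegralZl// -RintegralZl// -RintegralD//; last 2 first.
    exact: integrable_scale.
    exact: integrable_scale.
  have P5 := integrable_add (integrable_scale t P2) (integrable_scale t^-1 rho4).
  rewrite -RintegralZl//; apply: le_Rintegral => //.
  - apply: eq_integrable (integrable_norm P3) => // x _ /=.
    by rewrite normrX.
  - exact: integrable_scale.
  - by move=> x _; exact: norm_cube_le.
have nu1 := @integrable_pow _ _ 1 isT nu4.
have wi : intg nu (fun x : R => 1 + `|x|).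
  exact: integrable_add (integrable_cst_prob nu 1) (integrable_norm nu1).
(* This 2 cancels the factor 1/2 in the bounds on E|Y| and E|Y|^3. *)
have w2 : \int[nu]_x (1 + `|(x : R)|) <= 2.
  rewrite RintegralD//; last 2 first.
    exact: integrable_cst_prob.
    exact: (integrable_norm nu1).
  by rewrite Rintegral_prob_cst -[leRHS]/(1 + 1) lerD2l.
have w0 : 0 <= \int[nu]_x (1 + `|(x : R)|).
  by apply: Rintegral_ge0 => x _; rewrite addr_ge0.
have a1 := integrable_scale L (integrable_norm (rho_i (i := 1) isT)).
have a3 : intg rho (fun x : R => L * `|x| ^+ 3).
  apply: integrable_scale; apply: eq_integrable (integrable_norm (rho_i (i := 3) isT)) => // x _ /=.
  by rewrite normrX.
have err1 : `|\int[(rho \x nu)%E]_z (df (z.1 + z.2) - df z.2)| <=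
    L * (t + t^-1 * s2).
  apply: (@le_trans _ _ (\int[(rho \x nu)%E]_z (L * `|(z.1 : R)| * (1 + `|(z.2 : R)|)))).
    apply: Rintegral_le_norm.
    - apply: measurable_funB; first exact: measurable_convolution_fun.
      exact: measurableT_comp.
    - exact: integrable_prod a1 wi.
    - move=> z; rewrite (le_trans (stein_derive_lipschitz _ _))//.
      by rewrite [X in `|X|]addrK.
  rewrite (Rintegral_prod a1 wi) RintegralZl//; last exact: (integrable_norm (rho_i (i := 1) isT)).
  rewrite -mulrA ler_wpM2l//.
  apply: (@le_trans _ _ (2^-1 * (t + t^-1 * s2) * 2)); last by lra.
  apply: ler_pM; [|exact: w0|exact: rho_abs|exact: w2].
  by apply: Rintegral_ge0 => x _; exact: normr_ge0.
have err2 : `|\int[(rho \x nu)%E]_z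
     ((z.1 : R) * (f (z.2 + z.1) - f z.2 - (z.1 : R) * df z.2))| <=
    L * (t * s2 + t^-1 * m4).
  apply: (@le_trans _ _ (\int[(rho \x nu)%E]_z (L * `|(z.1 : R)| ^+ 3 * (1 + `|(z.2 : R)|)))).
    apply: Rintegral_le_norm.
    - apply: measurable_funM; first exact: measurable_fst.
      apply: measurable_funB; last first.
        apply: measurable_funM; first exact: measurable_fst.
        exact: measurableT_comp.
      apply: measurable_funB; last exact: measurableT_comp.
      rewrite (_ : (fun _ => _) = (fun z : mR * mR => f (z.1 + z.2))); last first.
        by apply/funext => z; rewrite addrC.
      exact: measurable_convolution_fun.
    - exact: integrable_prod a3 wi.
    - move=> z; rewrite normrM (le_trans (ler_wpM2l _ (stein_taylor _ _)))//.
      by rewrite -(real_normK (num_real z.1)) le_eqVlt; apply/orP; left; apply/eqP; ring.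
  rewrite (Rintegral_prod a3 wi) RintegralZl//; last first.
    apply: eq_integrable (integrable_norm (rho_i (i := 3) isT)) => // x _ /=.
    by rewrite normrX.
  rewrite -mulrA ler_wpM2l//.
  apply: (@le_trans _ _ (2^-1 * (t * s2 + t^-1 * m4) * 2)); last by lra.
  apply: ler_pM; [|exact: w0|exact: rho_cube|exact: w2].
  by apply: Rintegral_ge0 => x _; rewrite exprn_ge0.
(* Up to the factor L, the first error gives t + s2 / t and the second, times n + 1, gives t + (n +
   1) m4 / t, because (n + 1) s2 = 1. *)
rewrite stein_identity (le_trans (ler_normB _ _))//.
rewrite normrM (ger0_norm n0) (le_trans (lerD err1 (ler_wpM2l n0 err2)))//.
rewrite le_eqVlt; apply/orP; left; apply/eqP; rewrite -s2E.
transitivity (L * (t + t^-1 * s2 + (t * (n.+1%:R * s2) + t^-1 * (n.+1%:R * m4)))).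
  by ring.
by rewrite s2v; ring.
Qed.

End solution.

End stein_bound.

(** * Reduction of weak convergence to bounded Lipschitz test functions *)

Section lipschitz_test_functions.
Context (R : realType).
Local Notation mR := (measurableTypeR R).

Section inf_convolution.
Variables (f : R -> R) (B : R).
Hypothesis fB : forall x, `|f x| <= B.

(** The Pasch-Hausdorff envelope: for bounded [f], the largest k-Lipschitz function below [f]. *)
Definition inf_convolution (k : nat) (x : R) : R :=
  inf [set f y + k%:R * `|x - y| | y in [set: R]].

Local Notation g := inf_convolution.

Lemma inf_convolution_le (k : nat) (x y : R) : g k x <= f y + k%:R * `|x - y|.
Proof.
apply: ge_inf; last by exists y.
exists (- B) => _ [z _ <-]; rewrite ler_wpDr ?mulr_ge0//.
by have := fB z; rewrite ler_norml => /andP[].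
Qed.

Lemma le_inf_convolution (k : nat) (x m : R) :
  (forall y, m <= f y + k%:R * `|x - y|) -> m <= g k x.
Proof.
move=> fm; apply: lb_le_inf; first by exists (f 0 + k%:R * `|x - 0|), 0.
by move=> _ [z _ <-].
Qed.

Lemma inf_convolution_le_id (k : nat) (x : R) : g k x <= f x.
Proof. by rewrite (le_trans (inf_convolution_le k x x))// subrr normr0 mulr0 addr0. Qed.

Lemma inf_convolution_bounded (k : nat) (x : R) : `|g k x| <= B.
Proof.
rewrite ler_norml; apply/andP; split.
  apply: le_inf_convolution => y; rewrite ler_wpDr ?mulr_ge0//.
  by have := fB y; rewrite ler_norml => /andP[].
rewrite (le_trans (inf_convolution_le_id k x))//.
by have := fB x; rewrite ler_norml => /andP[].
Qed.

Lemma inf_convolution_lipschitz (k : nat) (x y : R) :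
  `|g k x - g k y| <= k%:R * `|x - y|.
Proof.
have le u v : g k u - g k v <= k%:R * `|u - v|.
  rewrite lerBlDr -lerBlDl; apply: le_inf_convolution => z.
  rewrite lerBlDl (le_trans (inf_convolution_le k u z))//.
  rewrite addrCA lerD2l -mulrDr ler_wpM2l//.
  by rewrite (le_trans _ (ler_normD _ _))// addrA subrK.
by rewrite ler_norml le andbT lerNl opprB distrC le.
Qed.

(** Near x, continuity keeps f above f(x) - e; at distance d or more, the penalty is at least the
    oscillation 2B of f once k >= 2B / d. *)
Lemma cvg_inf_convolution (x : R) : {for x, continuous f} ->
  g k x @[k --> \oo] --> f x.
Proof.
move=> /cvgrPdist_le cf; apply/cvgrPdist_le => e e0.
have [d /= d0 fd] := cf _ e0.
near=> k; rewrite ger0_norm ?subr_ge0 ?inf_convolution_le_id//.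
rewrite lerBlDr -lerBlDl; apply: le_inf_convolution => y.
have [xy|xy] := ltP `|x - y| d.
  have := fd y xy; rewrite ler_norml => /andP[_].
  have : 0 <= k%:R * `|x - y| by rewrite mulr_ge0.
  by move: (k%:R * _) => w; lra.
have kd : 2 * B <= k%:R * `|x - y|.
  apply: (@le_trans _ _ (k%:R * d)); last by rewrite ler_wpM2l.
  by rewrite -ler_pdivrMr//; near: k; exact: nbhs_infty_ger.
have := fB x; have := fB y; rewrite !ler_norml => /andP[fy _] /andP[_ fx].
by move: (k%:R * _) kd => w; lra.
Unshelve. all: by end_near. Qed.

End inf_convolution.

Section weak_convergence.
Variables (mu_ : nat -> probability mR R) (nu : probability mR R).
Hypothesis lip : forall (h : R -> R) (B K : R), (forall x, `|h x| <= B) ->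
  (forall x y, `|h x - h y| <= K * `|x - y|) ->
  \int[mu_ n]_x h x @[n --> \oo] --> \int[nu]_x h x.

(** The envelopes lie below [f], so replacing [f] by one of them controls the integrals from one
    side; the other side is obtained from - f. *)
Lemma lower_bound_near (f : R -> R) (B e : R) :
  continuous f -> (forall x, `|f x| <= B) -> 0 < e ->
  \forall n \near \oo, \int[nu]_x f x - e <= \int[mu_ n]_x f x.
Proof.
move=> cf fB e0; have e20 : 0 < e / 2 by rewrite divr_gt0.
have mf : measurable_fun [set: mR] f by exact: continuous_measurable_fun.
have fi (P : probability mR R) : intg P f by exact: integrable_bounded mf fB.
pose g := inf_convolution f.
have mg k : measurable_fun [set: mR] (g k).
  apply: continuous_measurable_fun.
  exact: dist_le_continuous (inf_convolution_lipschitz fB k).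
have gi (P : probability mR R) k : intg P (g k).
  exact: integrable_bounded (mg k) (inf_convolution_bounded fB k).
(* Dominated convergence is applied under the limit law alone, so that k is fixed before n
   varies. *)
have : \int[nu]_x g k x @[k --> \oo] --> \int[nu]_x f x.
  apply: fine_cvg; rewrite -EFin_Rintegral; last exact: fi.
  have [] // := @dominated_convergence _ _ _ nu _ measurableT
    (fun k x => (g k x)%:E) (EFin \o f) (fun=> B%:E).
  - move=> k; apply/measurable_EFinP; exact: mg.
  - exact/measurable_EFinP.
  - apply: aeW => x _; apply: cvg_EFin; first exact: nearW.
    by apply: cvg_inf_convolution; [exact: fB|exact: cf].
  - exact: integrable_cst_prob.
  - by apply: aeW => x k _ /=; rewrite lee_fin inf_convolution_bounded.
move=> /cvgrPdist_le /(_ _ e20) [k _ /(_ k (leqnn k)) /= fgk].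
have /cvgrPdist_le /(_ _ e20) := lip (inf_convolution_bounded fB k) (inf_convolution_lipschitz fB k).
apply: filterS => n gn.
have : \int[mu_ n]_x g k x <= \int[mu_ n]_x f x.
  apply: le_Rintegral; [exact: measurableT|exact: gi|exact: fi|].
  by move=> x _; exact: inf_convolution_le_id fB k x.
move: fgk gn; rewrite !ler_norml => /andP[_ h1] /andP[_ h2].
by lra.
Qed.

Lemma weak_cvg_lipschitz : weak_cvg mu_ nu.
Proof.
(* [bounded_fun] bounds |f| by every number strictly above M, and |M| + 1 is one. *)
move=> f cf [M [_ fM]]; pose B := `|M| + 1.
have fB x : `|f x| <= B.
  by apply: (fM B) => //; rewrite /B (le_lt_trans (ler_norm M))// ltrDl.
have mf : measurable_fun [set: mR] f by exact: continuous_measurable_fun.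
have fi (P : probability mR R) : intg P f by exact: integrable_bounded mf fB.
rewrite EFin_Rintegral; last exact: fi.
apply/fine_cvgP; split; first by apply: nearW => n; exact: integrable_fin_num (fi _).
apply/cvgrPdist_le => e e0.
have cNf : continuous (fun x => - f x) by move=> x; apply: cvgN; exact: cf.
have NfB x : `|- f x| <= B by rewrite normrN.
have N (P : probability mR R) : \int[P]_x (- f x) = - \int[P]_x f x.
  under eq_Rintegral do rewrite -mulN1r.
  by rewrite (RintegralZl _ measurableT (fi P)) mulN1r.
have := lower_bound_near cf fB e0; have := lower_bound_near cNf NfB e0.
apply: filterS2 => n; rewrite !N => h1 h2.
rewrite -[X in _ - X]/(\int[mu_ n]_x f x) ler_norml; apply/andP.
by split; lra.
Qed.

End weak_convergence.
End lipschitz_test_functions.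

(** * Quantitative distance of a divisible law to the Gaussian law *)

Section divisible_laws.
Context (R : realType).
Local Notation mR := (measurableTypeR R).

(** [L] comes from the Stein solution for [h], hence precedes n, [mu] and t. In the term 4 / (n +
    1), three parts come from the fourth moment of the sum and one from the bound on E|Y|. *)
Lemma divisible_estimate (h : R -> R) (B K : R) :
  (forall x, `|h x| <= B) -> (forall x y, `|h x - h y| <= K * `|x - y|) ->
  exists2 L : R, 0 <= L & forall (n : nat) (mu : probability mR R) (t : R),
    divisible n.+1 mu -> intg mu (fun x : R => x ^+ 4) ->
    \int[mu]_x (x : R) = 0 -> \int[mu]_x ((x : R) ^+ 2) = 1 -> 0 < t ->
    `|\int[mu]_x h x - \int[normal_prob 0 1]_x h x| <=
    L * (2 * t + (\int[mu]_x ((x : R) ^+ 4) - 3 + 4 * n.+1%:R^-1) / t).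
Proof.
move=> hB hK; have ch := dist_le_continuous hK.
have mh : measurable_fun [set: mR] h by exact: continuous_measurable_fun.
have [f [A [fdf fA xfA]]] := stein_equation_solution ch hB.
have cB : `|\int[@normal_prob R 0 1]_y h y| <= B.
  rewrite -[B](Rintegral_prob_cst (@normal_prob R 0 1)).
  exact: Rintegral_le_norm mh (integrable_cst_prob _ B) hB.
exists (A + (A + 2 * B) + K).
  have K0 := dist_le_cst_ge0 hK.
  by rewrite !addr_ge0 ?mulr_ge0 ?(le_trans _ (fA 0)) ?(le_trans _ (hB 0)).
move=> n mu t [rho mu_rho] mu4 mu_mean mu_var t0.
have muE (g : R -> R) : \int[mu]_x g x = \int[convolution_pow rho n.+1]_x g x.
  by congr fine; apply: eq_measure_integral => D mD _; exact: mu_rho.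
have S4 : intg (convolution_pow rho n.+1) (fun x : R => x ^+ 4).
  have /integrableP[m4 i4] := mu4; apply/integrableP; split => //.
  by rewrite (eq_measure_integral mu)// => D mD _; exact/esym/mu_rho.
have rho4 : intg rho (fun x : R => x ^+ 4) by exact: integrable_deconvolution4 S4.
have n0 : n.+1%:R != 0 :> R by rewrite pnatr_eq0.
have rho_mean : \int[rho]_x ((x : R) ^+ 1) = 0.
  apply: (mulfI n0); rewrite mulr0 -mean_convolution_pow// -(muE (fun x => x ^+ 1)).
  exact: mu_mean.
have rho_var : n.+1%:R * \int[rho]_x ((x : R) ^+ 2) = 1.
  by rewrite -moment2_convolution_pow// -(muE (fun x => x ^+ 2)).
have := stein_estimate hB cB hK fdf fA xfA rho4 rho_mean rho_var t0.
rewrite -muE => /le_trans; apply.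
rewrite le_eqVlt; apply/orP; left; apply/eqP; congr (_ * (_ + _ / _)).
rewrite (muE (fun x => x ^+ 4)) moment4_convolution_pow//.
have -> : \int[rho]_x ((x : R) ^+ 2) = n.+1%:R^-1.
  by rewrite -[LHS](mulKf n0) rho_var mulr1.
by field.
Qed.

End divisible_laws.

(** * Choice of the free parameter t and passage to the limit *)

Theorem theorem1p7 (R : realType)
  (mu_ : nat -> probability (measurableTypeR R) R)
  (mean0 : forall n, (0 < n)%N -> 'E_(mu_ n)[fun x => x]%E = 0%:E)
  (var1 : forall n, (0 < n)%N -> 'V_(mu_ n)[fun x => x]%E = 1%:E)
  (div_mu : forall n, (0 < n)%N -> divisible n (mu_ n))
  (d : nat -> measure_display) (T : forall n, measurableType (d n))
  (P : forall n, probability (T n) R)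
  (X : forall n, {RV (P n) >-> measurableTypeR R})
  (law_X : forall n, (0 < n)%N -> has_law (X n) (mu_ n))
  (fourth : 'E_(P n)[fun w => ((X n w : R) ^+ 4)%R]%E @[n --> \oo] --> 3%:E) :
  weak_cvg mu_ (normal_prob 0 1).
Proof.
pose kappa n : R := \int[mu_ n]_x (x ^+ 4).
have fourthE n : (0 < n)%N -> 'E_(P n)[fun w => ((X n w : R) ^+ 4)%R]%E =
    (\int[mu_ n]_x ((x : R) ^+ 4)%:E)%E.
  move=> n0; rewrite unlock.
  rewrite [RHS](eq_measure_integral (distribution (P n) (X n))); last first.
    by move=> D mD _; exact/esym/law_X.
  rewrite ge0_integral_distribution//.
    by apply/measurable_EFinP; exact: measurable_pow.
  by move=> x; rewrite lee_fin exprn_even_ge0.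
(* Convergence of extended reals to a finite limit makes the fourth moments finite from some n on;
   the integrability of x^4 is drawn from here. *)
have [finE kappa_cvg] : (\forall n \near \oo, (\int[mu_ n]_x ((x : R) ^+ 4)%:E)%E \is a fin_num)
    /\ kappa n @[n --> \oo] --> (3 : R).
  apply/fine_cvgP; apply: cvg_trans fourth; apply: near_eq_cvg.
  by near=> n; rewrite fourthE//; near: n; exact: nbhs_infty_gt.
apply: weak_cvg_lipschitz => h B K hB hK.
have [L L0 hL] := divisible_estimate hB hK.
apply/cvgrPdist_le => e e0.
pose u n : R := kappa n - 3 + 4 * n%:R^-1.
have u_cvg : u n @[n --> \oo] --> (0 : R).
  have : kappa n - 3 + 4 * n%:R^-1 @[n --> \oo] --> 3 - 3 + 4 * (0 : R).
    apply: cvgD; first by apply: cvgB; [exact: kappa_cvg|exact: cvg_cst].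
    apply: cvgM; first exact: cvg_cst.
    by rewrite -(cvg_shiftS (fun n : nat => n%:R^-1 : R)); exact: cvg_harmonic.
  by rewrite subrr mulr0 addr0.
(* Chosen so that (L + 1) 4t = e; L + 1 stands in for L, which may be zero. *)
pose t : R := e / (4 * (L + 1)).
have L10 : 0 < L + 1 by rewrite ltr_wpDl.
have t0 : 0 < t by rewrite divr_gt0// mulr_gt0.
(* The threshold 2 t^2 makes u(n) / t at most 2t, so the estimate becomes 4 L t, which is at most
   e. *)
have ut : \forall n \near \oo, `|u n| <= t * (2 * t).
  move/cvgr0Pnorm_le: u_cvg; apply.
  exact: mulr_gt0 t0 (mulr_gt0 (ltr0n _ 2) t0).
near=> n.
have n0 : (0 < n)%N by near: n; exact: nbhs_infty_gt.
have mu4 : intg (mu_ n) (fun x : R => x ^+ 4).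
  apply/integrableP; split.
    by apply/measurable_EFinP; exact: measurable_pow.
  rewrite (eq_integral (fun x : measurableTypeR R => ((x : R) ^+ 4)%:E)); last first.
    by move=> x _ /=; rewrite ger0_norm// exprn_even_ge0.
  rewrite -ge0_fin_numE; first by near: n; exact: finE.
  by apply: integral_ge0 => x _; rewrite lee_fin exprn_even_ge0.
have mean : \int[mu_ n]_x (x : R) = 0.
  by have := mean0 n n0; rewrite unlock /Rintegral => ->.
have var : \int[mu_ n]_x ((x : R) ^+ 2) = 1.
  have := var1 n n0; rewrite /variance covariance.unlock mean0// expectation.unlock /= => v.
  rewrite /Rintegral (_ : (\int[mu_ n]_x (x ^+ 2)%:E)%E = 1%E)//.
  rewrite -v; apply: eq_integral => x _.
  by rewrite expr2 -[x in LHS]subr0.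
have ne : n = n.-1.+1 by rewrite prednK.
have := hL n.-1 (mu_ n) t; rewrite -ne => /(_ (div_mu n n0) mu4 mean var t0).
rewrite distrC => /le_trans; apply.
have utn : u n / t <= 2 * t.
  rewrite ler_pdivrMr// mulrC (le_trans (ler_norm _))//.
  by near: n.
apply: (@le_trans _ _ (L * (2 * t + 2 * t))); first by rewrite ler_wpM2l// lerD2l.
have te : (L + 1) * (4 * t) = e by rewrite /t; field; rewrite gt_eqF.
by rewrite -te; nra.
Unshelve. all: by end_near.
Qed.
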